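(* The following fourteen mesh patterns $(12,R)$ are pairwise equidistributed, where $R$ ranges over: $\{(0,2),(1,2),(2,2),(0,1),(1,1)\}$, $\{(0,2),(1,2),(0,1),(1,1),(0,0)\}$, $\{(2,2),(1,1),(2,1),(1,0),(2,0)\}$, $\{(1,1),(2,1),(0,0),(1,0),(2,0)\}$, $\{(0,2),(1,2),(2,2),(0,1),(0,0)\}$, $\{(2,2),(2,1),(0,0),(1,0),(2,0)\}$, $\{(0,2),(2,2),(0,1),(2,1),(0,0)\}$, $\{(0,2),(1,2),(2,2),(0,0),(1,0)\}$, $\{(2,2),(0,1),(2,1),(0,0),(2,0)\}$, $\{(1,2),(2,2),(0,0),(1,0),(2,0)\}$, $\{(0,2),(0,1),(1,1),(2,1),(0,0)\}$, $\{(0,2),(1,2),(2,2),(1,1),(1,0)\}$, $\{(2,2),(0,1),(1,1),(2,1),(2,0)\}$, $\{(1,2),(1,1),(0,0),(1,0),(2,0)\}$. Moreover, for each such pattern $p$ and $n\ge1$, $\sum_{\pi\in S_n}q^{p(\pi)}=(n-1)!+q\,(n-1)(n-1)!$.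
   Context: For $R\subseteq\{0,1,2\}^2$ and $\pi=\pi_1\cdots\pi_n\in S_n$, an occurrence of the mesh pattern $(12,R)$ in $\pi$ is a pair of positions $i_1<i_2$ with $\pi_{i_1}<\pi_{i_2}$ such that, setting $x_0=0,x_1=i_1,x_2=i_2,x_3=n+1$ and $y_0=0,y_1=\pi_{i_1},y_2=\pi_{i_2},y_3=n+1$, for every $(a,b)\in R$ there is no index $k$ with $x_a<k<x_{a+1}$ and $y_b<\pi_k<y_{b+1}$. $p(\pi)$ is the number of occurrences of $p$ in $\pi$; $s_{n,k}(p)$ the number of $\pi\in S_n$ with $p(\pi)=k$; $p_1,p_2$ are equidistributed if $s_{n,k}(p_1)=s_{n,k}(p_2)$ for all $n,k\ge 0$. *)

(* Defs.v *)
From mathcomp Require Import all_boot all_order all_algebra all_fingroup.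

Set Implicit Arguments.
Unset Strict Implicit.
Unset Printing Implicit Defensive.

(* The shading R of a mesh pattern (12, R); in a cell (a, b), a is the column
   (positions) and b is the row (values). *)
Definition mesh12 : Type := {set 'I_3 * 'I_3}.

Definition cells (l : seq (nat * nat)) : mesh12 :=
  [set c | (val c.1, val c.2) \in l].

(* Permutations are 0-based ('S_n permutes {0, .., n-1}); the positions and
   values of the mathematical definition are the successors of ours, whence the
   .+1 below and the boundary lines at 0 and n.+1. *)
Definition col_line (n : nat) (i : 'I_n * 'I_n) (a : nat) : nat :=
  nth 0 [:: 0; i.1.+1; i.2.+1; n.+1] a.

Definition row_line (n : nat) (s : 'S_n) (i : 'I_n * 'I_n) (b : nat) : nat :=
  nth 0 [:: 0; (s i.1).+1; (s i.2).+1; n.+1] b.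

Definition in_cell (n : nat) (s : 'S_n) (i : 'I_n * 'I_n) (c : 'I_3 * 'I_3)
    (k : 'I_n) : bool :=
  (col_line i c.1 < k.+1 < col_line i c.1.+1) &&
  (row_line s i c.2 < (s k).+1 < row_line s i c.2.+1).

Definition occurrence (R : mesh12) (n : nat) (s : 'S_n) (i : 'I_n * 'I_n)
    : bool :=
  [&& i.1 < i.2, s i.1 < s i.2 &
      [forall c in R, ~~ [exists k : 'I_n, in_cell s i c k]]].

Definition occ (R : mesh12) (n : nat) (s : 'S_n) : nat :=
  #|[set i : 'I_n * 'I_n | occurrence R s i]|.

Definition num_occ (n k : nat) (R : mesh12) : nat :=
  #|[set s : 'S_n | occ R s == k]|.

Definition equidistributed (R1 R2 : mesh12) : Prop :=
  forall n k : nat, num_occ n k R1 = num_occ n k R2.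

Definition fourteen_patterns : seq mesh12 :=
  [:: cells [:: (0,2); (1,2); (2,2); (0,1); (1,1)];
      cells [:: (0,2); (1,2); (0,1); (1,1); (0,0)];
      cells [:: (2,2); (1,1); (2,1); (1,0); (2,0)];
      cells [:: (1,1); (2,1); (0,0); (1,0); (2,0)];
      cells [:: (0,2); (1,2); (2,2); (0,1); (0,0)];
      cells [:: (2,2); (2,1); (0,0); (1,0); (2,0)];
      cells [:: (0,2); (2,2); (0,1); (2,1); (0,0)];
      cells [:: (0,2); (1,2); (2,2); (0,0); (1,0)];
      cells [:: (2,2); (0,1); (2,1); (0,0); (2,0)];
      cells [:: (1,2); (2,2); (0,0); (1,0); (2,0)];
      cells [:: (0,2); (0,1); (1,1); (2,1); (0,0)];
      cells [:: (0,2); (1,2); (2,2); (1,1); (1,0)];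
      cells [:: (2,2); (0,1); (1,1); (2,1); (2,0)];
      cells [:: (1,2); (1,1); (0,0); (1,0); (2,0)]].

(* Main.v *)
Require Import Defs.
From mathcomp Require Import all_boot all_order all_algebra all_fingroup.
From mathcomp Require Import zify.

Set Implicit Arguments.
Unset Strict Implicit.
Unset Printing Implicit Defensive.

(** Reflecting the plane in the diagonal ([s] becomes [s^-1]) and rotating it by
    a half turn (reverse-complement) reduce the fourteen patterns to the first,
    fifth, seventh and eleventh. For each of these four, [s] has no
    occurrence when its first entry is its maximum. Otherwise it has exactly
    one, and its two entries are, respectively: the largest entry before the
    maximum, and the maximum; the first entry [f] and the maximum; [f] and the
    last entry above [f]; [f] and the entry with value [f + 1]. *)

(** * Symmetries of mesh patterns *)

(** The maps [phi], [psi] and [g] carry pairs, cells and points from [s] to [s']. Injective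
    self-maps of finite types are bijective, so every cell of [R] and every entry of [s'] can also
    be pulled back. *)
Lemma occ_transport (R R' : mesh12) (n : nat) (s s' : 'S_n)
    (phi : 'I_n * 'I_n -> 'I_n * 'I_n) (psi : 'I_3 * 'I_3 -> 'I_3 * 'I_3)
    (g : 'I_n -> 'I_n) :
  injective phi -> injective psi -> injective g ->
  (forall c, (c \in R') = (psi c \in R)) ->
  (forall i : 'I_n * 'I_n, (i.1 < i.2) && (s i.1 < s i.2) =
     ((phi i).1 < (phi i).2) && (s' (phi i).1 < s' (phi i).2)) ->
  (forall i c k, in_cell s i c k = in_cell s' (phi i) (psi c) (g k)) ->
  occ R' s = occ R s'.
Proof.
move=> phi_inj psi_inj g_inj RR' ord_phi cell_phi.
have [psi' psiK psi'K] := injF_bij psi_inj.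
have [g' gK g'K] := injF_bij g_inj.
rewrite /occ -[RHS](card_preimset _ phi_inj); apply: eq_card => i.
rewrite !inE /occurrence 2!andbA ord_phi; congr (_ && _).
apply/forall_inP/forall_inP => H c Rc; apply/existsPn => k.
- have /H/existsPn/(_ (g' k)) : psi' c \in R' by rewrite RR' psi'K.
  by rewrite cell_phi psi'K g'K.
- by move: Rc; rewrite RR' => /H/existsPn/(_ (g k)); rewrite cell_phi.
Qed.

Definition mesh_tr (R : mesh12) : mesh12 := [set c | (c.2, c.1) \in R].

Definition mesh_rot (R : mesh12) : mesh12 :=
  [set c | (rev_ord c.1, rev_ord c.2) \in R].

Lemma occ_tr (R : mesh12) (n : nat) (s : 'S_n) :
  occ (mesh_tr R) s = occ R (s^-1)%g.
Proof.
(* Reflection sends the point [(k, s k)] to [(s k, k)], so positions are moved by [s] itself. *)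
apply: (@occ_transport _ _ _ _ _ (fun i => (s i.1, s i.2))
          (fun c => (c.2, c.1)) s) => /=.
- by case=> [i j] [i' j'] [/perm_inj-> /perm_inj->].
- by case=> [a b] [a' b'] [-> ->].
- exact: perm_inj.
- by move=> c; rewrite inE.
- by move=> i; rewrite !permK andbC.
- by move=> i c k; rewrite /in_cell /col_line /row_line /= !permK andbC.
Qed.

Definition rev_perm (n : nat) : 'S_n := perm (@rev_ord_inj n).

Lemma occ_rot (R : mesh12) (n : nat) (s : 'S_n) :
  occ (mesh_rot R) s = occ R (rev_perm n * s * rev_perm n)%g.
Proof.
(* A half turn reverses the order of positions, so the two entries trade places. *)
apply: (@occ_transport _ _ _ _ _ (fun i => (rev_ord i.2, rev_ord i.1))
          (fun c => (rev_ord c.1, rev_ord c.2)) (@rev_ord n)) => /=.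
- by apply: inv_inj => -[i ?] /=; rewrite !rev_ordK.
- by apply: inv_inj => -[a ?] /=; rewrite !rev_ordK.
- exact: rev_ord_inj.
- by move=> c; rewrite inE.
- move=> i; rewrite !permM !permE !rev_ordK /=.
  move: (ltn_ord i.1) (ltn_ord i.2) (ltn_ord (s i.1)) (ltn_ord (s i.2)); lia.
- move=> i c k; rewrite /in_cell /col_line /row_line /= !permM !permE !rev_ordK /=.
  move: (ltn_ord i.1) (ltn_ord i.2) (ltn_ord (s i.1)) (ltn_ord (s i.2)).
  move: (ltn_ord k) (ltn_ord (s k)).
  by case: c => [[[|[|[|a]]] ?] [[|[|[|b]]] ?]] //=; lia.
Qed.

Lemma mesh_tr_cells (l : seq (nat * nat)) :
  mesh_tr (cells l) = cells [seq (c.2, c.1) | c <- l].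
Proof.
apply/setP => -[a b]; rewrite !inE /=.
apply/idP/mapP => [?|[[b' a'] ? [-> ->]] //]; by exists (val b, val a).
Qed.

(** Below 3, [2 - _] acts as [rev_ord]. A pair outside the grid, which [cells] ignores, could be
    truncated into it, hence the bound. *)
Lemma mesh_rot_cells (l : seq (nat * nat)) :
  all (fun c => (c.1 < 3) && (c.2 < 3)) l ->
  mesh_rot (cells l) = cells [seq (2 - c.1, 2 - c.2) | c <- l].
Proof.
move=> /allP l3; apply/setP => -[a b]; rewrite !inE /=.
have [a3 b3] := (ltn_ord a, ltn_ord b).
apply/idP/mapP => [H|[[a' b'] ab']].
  by eexists; [exact: H|congr pair => /=; lia].
have /= ? := l3 _ ab'; move=> [-> ->].
by have -> : (3 - (2 - a').+1, 3 - (2 - b').+1) = (a', b') by congr pair; lia.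
Qed.

Lemma eq_cells (l l' : seq (nat * nat)) : perm_eq l l' -> cells l = cells l'.
Proof. by move=> /perm_mem ll'; apply/setP => c; rewrite !inE ll'. Qed.

(** * The four base patterns *)

(** For a concrete list, [all] unfolds at each [k] into inequalities that [lia] can settle. *)
Lemma occurrence_cellsE (l : seq (nat * nat)) (n : nat) (s : 'S_n) i :
  all (fun c => (c.1 < 3) && (c.2 < 3)) l ->
  occurrence (cells l) s i =
  [&& i.1 < i.2, s i.1 < s i.2 &
    [forall k : 'I_n, all (fun c => ~~
      ((col_line i c.1 < k.+1 < col_line i c.1.+1) &&
       (row_line s i c.2 < (s k).+1 < row_line s i c.2.+1))) l]].
Proof.
move=> /allP l3; congr [&& _, _ & _].
apply/forall_inP/forallP => [H k|H c].
  apply/allP => -[a b] ab; have /andP[/= a3 b3] := l3 _ ab.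
  have /H/existsPn/(_ k) // : (Ordinal a3, Ordinal b3) \in cells l.
  by rewrite inE.
by rewrite inE => cl; apply/existsPn => k; have /allP/(_ _ cl) := H k.
Qed.

Lemma occ_of_unique (R : mesh12) (n : nat) (s : 'S_n.+1) :
  (s ord0 = ord_max -> forall i, ~~ occurrence R s i) ->
  (s ord0 != ord_max -> exists i0, occurrence R s i0 /\
     forall i, occurrence R s i -> i = i0) ->
  occ R s = (s ord0 != ord_max).
Proof.
rewrite /occ; have [E /(_ E) H _|_ _ /(_ isT) [i0 [Hi0 H]]] := eqVneq.
  by apply: eq_card0 => i; rewrite inE; apply/negbTE.
rewrite /= -(cards1 i0); apply: eq_card => i; rewrite !inE.
by apply/idP/eqP => [/H|->].
Qed.

Lemma val_perm_inj (n : nat) (s : 'S_n) (i j : 'I_n) :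
  val (s i) = val (s j) -> i = j.
Proof. by move=> /val_inj/perm_inj. Qed.

Lemma perm_pre_max (n : nat) (s : 'S_n.+1) :
  s ord0 != ord_max ->
  exists m : 'I_n.+1, [/\ 0 < m, s m = n :> nat & s ord0 < n].
Proof.
move=> s0; exists (s^-1 ord_max)%g; rewrite permKV; split=> //.
  by rewrite lt0n; apply: contra s0 => /eqP/(@ord_inj _ _ ord0) <-; rewrite permKV.
by rewrite ltn_neqAle -ltnS ltn_ord andbT.
Qed.

(** The first entry cannot be the lower end of an ascent, being the maximum, nor the upper end,
    being first. *)
Lemma asc_of_max_first (n : nat) (s : 'S_n.+1) (i j : 'I_n.+1) :
  s ord0 = ord_max -> i < j -> s i < s j -> 0 < i /\ s j < n.
Proof.
move=> s0 ij sij; split.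
  rewrite lt0n; apply: contraTneq sij => /(@ord_inj _ _ ord0) ->.
  by rewrite s0 -leqNgt -ltnS.
rewrite ltn_neqAle -ltnS ltn_ord andbT; apply: contraTneq ij => sj.
by rewrite (@val_perm_inj _ s j ord0) ?s0.
Qed.

Definition first_not_max (R : mesh12) : Prop :=
  forall (n : nat) (s : 'S_n.+1), occ R s = (s ord0 != ord_max).

Lemma first_not_max1 :
  first_not_max (cells [:: (0,2); (1,2); (2,2); (0,1); (1,1)]).
Proof.
move=> n s; apply: occ_of_unique => [s0 [i j]|].
  rewrite occurrence_cellsE //=; apply/and3P => -[ij sij /forallP/(_ ord0)] /=.
  (* The first entry lies in the shaded cell (0,2). *)
  have [] := asc_of_max_first s0 ij sij; rewrite /col_line /row_line s0 /=; lia.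
move=> /perm_pre_max [m [m0 sm s0]].
have [f fm fmax] := @arg_maxnP _ ord0 (fun k : 'I_n.+1 => k < m)
  (fun k => s k) m0.
have {}fmax (k : 'I_n.+1) : k < m -> s k <= s f := fmax k.
have sfm : s f < s m.
  rewrite sm ltn_neqAle -ltnS ltn_ord andbT; apply: contraTneq fm => sf.
  by rewrite (@val_perm_inj _ s f m) ?ltnn //= sf sm.
exists (f, m); split=> [|[i j]]; rewrite occurrence_cellsE //=.
  rewrite fm sfm; apply/forallP => k; rewrite /col_line /row_line /=.
  have := ltn_ord (s k); have := fmax k; lia.
move=> /and3P[ij sij /forallP H].
(* The whole top row is shaded, so no entry exceeds [s j]. *)
have jE : j = m.
  apply: (@val_perm_inj _ s).
  have := H m; rewrite /col_line /row_line /= sm.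
  have := ltn_ord (s j); have := ltn_ord m.
  have [im|im|/val_inj im] := ltngtP i m; last by move: sij; rewrite im sm; lia.
    have [jm|jm|/val_inj -> //] := ltngtP j m; lia.
  lia.
(* Otherwise [f] would lie in one of the shaded cells (0,1) and (1,1). *)
have iE : i = f.
  move: ij sij H; rewrite jE => im sim H.
  apply: (@val_perm_inj _ s).
  have := fmax i im; have := H f; rewrite /col_line /row_line /=.
  have [fi|fi|/val_inj -> //] := ltngtP f i; lia.
by rewrite iE jE.
Qed.

(** Otherwise position 0 lies strictly inside column 0, and its value, being distinct from [s i] and
    [s j], falls in one of the three shaded cells there. *)
Lemma occurrence_first (l : seq (nat * nat)) (n : nat) (s : 'S_n.+1) i j :
  occurrence (cells l) s (i, j) ->
  all (fun c => (c.1 < 3) && (c.2 < 3)) l ->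
  all (mem l) [:: (0,0); (0,1); (0,2)] -> i = ord0.
Proof.
move=> + l3 /allP l0; rewrite occurrence_cellsE //= => /and3P[ij sij /forallP/(_ ord0)].
move=> /allP H; apply/eqP; apply/negPn/negP => i0.
have {}i0 : 0 < i by rewrite lt0n; apply: contra i0 => /eqP/(@ord_inj _ _ ord0)/eqP.
have := H _ (l0 (0,0) isT); have := H _ (l0 (0,1) isT).
have := H _ (l0 (0,2) isT).
rewrite /col_line /row_line /=; have := ltn_ord (s ord0).
have [si|si|/val_perm_inj i0E] := ltngtP (s ord0) (s i); last by rewrite -i0E in i0.
  lia.
have [sj|sj|/val_perm_inj j0E] := ltngtP (s ord0) (s j); last by rewrite -j0E in ij.
  lia.
lia.
Qed.

Lemma first_not_max5 :
  first_not_max (cells [:: (0,2); (1,2); (2,2); (0,1); (0,0)]).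
Proof.
move=> n s; apply: occ_of_unique => [s0 [i j]|].
  apply/negP => occ_ij; have i0 := occurrence_first occ_ij isT isT.
  move: occ_ij; rewrite occurrence_cellsE //= => /and3P[ij sij _].
  by have [] := asc_of_max_first s0 ij sij; rewrite i0.
move=> /perm_pre_max [m [m0 sm s0]].
exists (ord0, m); split=> [|[i j] occ_ij].
  rewrite occurrence_cellsE //= m0 sm s0; apply/forallP => k.
  rewrite /col_line /row_line /=; have := ltn_ord (s k); lia.
have -> : i = ord0 by apply: occurrence_first occ_ij isT isT.
(* As the top row is shaded, the maximum can only be at [j]. *)
move: occ_ij; rewrite occurrence_cellsE //= => /and3P[ij sij /forallP/(_ m) H].
congr pair; apply: (@val_perm_inj _ s); move: H.
have := ltn_ord (s j); have := ltn_ord m; rewrite /col_line /row_line /= sm.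
have [im|im|/val_inj im] := ltngtP i m; last by move: sij; rewrite im sm; lia.
  have [jm|jm|/val_inj -> //] := ltngtP j m; lia.
lia.
Qed.

Lemma first_not_max7 :
  first_not_max (cells [:: (0,2); (2,2); (0,1); (2,1); (0,0)]).
Proof.
move=> n s; apply: occ_of_unique => [s0 [i j]|].
  apply/negP => occ_ij; have i0 := occurrence_first occ_ij isT isT.
  move: occ_ij; rewrite occurrence_cellsE //= => /and3P[ij sij _].
  by have [] := asc_of_max_first s0 ij sij; rewrite i0.
move=> /perm_pre_max [m [m0 sm s0]].
have sm0 : s ord0 < s m by rewrite sm.
have [f fm fmax] := @arg_maxnP _ m (fun k : 'I_n.+1 => s ord0 < s k) val sm0.
have {}fmax (k : 'I_n.+1) : s ord0 < s k -> k <= f := fmax k.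
exists (ord0, f); split=> [|[i j] occ_ij].
  rewrite occurrence_cellsE //= fm (leq_trans m0 (fmax _ sm0)).
  apply/forallP => k; rewrite /col_line /row_line /=.
  have := fmax k; lia.
have i0 : i = ord0 by apply: occurrence_first occ_ij isT isT.
move: occ_ij; rewrite i0 occurrence_cellsE //= => /and3P[ij sij /forallP/(_ f) H].
congr pair; apply: val_inj; move: H => /=.
rewrite /col_line /row_line /=; have := ltn_ord f; have := fmax j sij.
have := ltn_ord (s f).
(* If [j] came before [f], then [f] would lie in cell (2,1) or (2,2), according as [s f] is below or
   above [s j]. *)
have [sj|sj|/val_perm_inj -> //] := ltngtP (s f) (s j); lia.
Qed.

Lemma first_not_max11 :
  first_not_max (cells [:: (0,2); (0,1); (1,1); (2,1); (0,0)]).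
Proof.
move=> n s; apply: occ_of_unique => [s0 [i j]|].
  apply/negP => occ_ij; have i0 := occurrence_first occ_ij isT isT.
  move: occ_ij; rewrite occurrence_cellsE //= => /and3P[ij sij _].
  by have [] := asc_of_max_first s0 ij sij; rewrite i0.
move=> /perm_pre_max [m [m0 sm s0]].
(* The successor is a legal value because [s ord0 < n]. *)
pose f := (s^-1 (inord (s ord0).+1))%g.
have sf : s f = (s ord0).+1 :> nat by rewrite permKV inordK.
have f0 : 0 < f.
  by rewrite lt0n; apply/eqP => /(@ord_inj _ _ ord0) f0; move: sf; rewrite f0; lia.
exists (ord0, f); split=> [|[i j] occ_ij].
  rewrite occurrence_cellsE //= f0 sf leqnn /=.
  apply/forallP => k; rewrite /col_line /row_line /= sf; lia.
have i0 : i = ord0 by apply: occurrence_first occ_ij isT isT.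
move: occ_ij; rewrite i0 occurrence_cellsE //= => /and3P[ij sij /forallP/(_ f) H].
(* If [j] differs from [f], the value [s f] lies strictly between the first entry and [s j], so [f]
   falls in cell (1,1) or (2,1). *)
congr pair; apply: (@val_perm_inj _ s); move: H.
rewrite /col_line /row_line /= sf; have := ltn_ord f.
have [jf|jf|/val_inj -> //] := ltngtP j f; lia.
Qed.

(** * Distribution polynomials *)

Import GRing.Theory.
Local Open Scope ring_scope.

Definition occ_enum (R : mesh12) (n : nat) : {poly int} :=
  \sum_(s : 'S_n) 'X^(occ R s).

(** A symmetry may change the count on a single permutation, but it permutes ['S_n] and so preserves
    the sum. *)
Lemma occ_enum_tr (R : mesh12) (n : nat) : occ_enum (mesh_tr R) n = occ_enum R n.
Proof.
rewrite /occ_enum [RHS](reindex_inj invg_inj).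
by apply: eq_bigr => s _; rewrite occ_tr.
Qed.

Lemma occ_enum_rot (R : mesh12) (n : nat) :
  occ_enum (mesh_rot R) n = occ_enum R n.
Proof.
have inj : injective (fun s : 'S_n => rev_perm n * s * rev_perm n)%g.
  by move=> s s' /mulIg/mulgI.
rewrite /occ_enum [RHS](reindex_inj inj).
by apply: eq_bigr => s _; rewrite occ_rot.
Qed.

Lemma card_first_max (n : nat) :
  #|[set s : 'S_n.+1 | s ord0 == ord_max]| = n`!.
Proof.
have -> : n`! = #|perm_on [set~ (ord0 : 'I_n.+1)]|.
  by rewrite card_perm cardsC1 card_ord.
(* Composing with this transposition turns the condition into [s] fixing [ord0], that is, permuting
   the other [n] points. *)
rewrite -(card_preimset _ (mulIg (tperm ord0 ord_max))).
apply: eq_card => s; rewrite !inE permM.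
rewrite (can2_eq (tpermK _ _) (tpermK _ _)) tpermR.
apply/eqP/subsetP => [s0 x|H].
  by rewrite !inE; apply: contra => /eqP ->; rewrite s0.
by apply/eqP/negPn/negP => /H; rewrite !inE eqxx.
Qed.

Lemma occ_enum_first (R : mesh12) (n : nat) : first_not_max R ->
  occ_enum R n.+1 = (n`!)%:R + 'X * (n * n`!)%:R.
Proof.
move=> HR; rewrite /occ_enum (bigID (fun s : 'S_n.+1 => s ord0 == ord_max)) /=.
have card1 := card_first_max n.
(* The complement has size (n+1)! - n!. *)
have card2 : #|[set s : 'S_n.+1 | s ord0 != ord_max]| = (n * n`!)%N.
  have := cardsC [set s : 'S_n.+1 | s ord0 == ord_max].
  rewrite card1 card_Sn factS mulSn => /addnI <-.
  by apply: eq_card => s; rewrite !inE.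
congr (_ + _).
  rewrite -[in RHS]card1 -sum1_card natr_sum; apply: eq_big => s.
    by rewrite inE.
  by rewrite HR => ->.
rewrite -[in RHS]card2 -sum1_card natr_sum mulr_sumr; apply: eq_big => s.
  by rewrite inE.
by rewrite HR mulr1 => ->.
Qed.

(** Under reflection and half turn the fourteen patterns form three orbits of size four and one of
    size two, that of the fifth pattern, on which both symmetries agree. *)
Lemma occ_enum_fourteen (R : mesh12) (n : nat) : R \in fourteen_patterns ->
  occ_enum R n.+1 = (n`!)%:R + 'X * (n * n`!)%:R.
Proof.
pose good l := occ_enum (cells l) n.+1 = (n`!)%:R + 'X * (n * n`!)%:R.
have tr l l' : good l -> perm_eq [seq (c.2, c.1) | c <- l] l' -> good l'.
  by move=> gl /eq_cells E; rewrite /good -E -mesh_tr_cells occ_enum_tr.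
have rot l l' : good l -> all (fun c : nat * nat => (c.1 < 3) && (c.2 < 3))%N l ->
    perm_eq [seq (2 - c.1, 2 - c.2)%N | c <- l] l' -> good l'.
  by move=> gl l3 /eq_cells E; rewrite /good -E -mesh_rot_cells // occ_enum_rot.
have g1 := occ_enum_first n first_not_max1.
have g5 := occ_enum_first n first_not_max5.
have g7 := occ_enum_first n first_not_max7.
have g11 := occ_enum_first n first_not_max11.
(* Reflecting these three half turns gives the second, eighth and twelfth patterns. *)
have g4 := rot _ _ g1 isT (perm_refl _).
have g9 := rot _ _ g7 isT (perm_refl _).
have g13 := rot _ _ g11 isT (perm_refl _).
rewrite !inE => R14; repeat case/predU1P: R14 => [->|R14] //.
- by apply: (tr _ _ g4).
- by apply: (tr _ _ g1).
- by apply: (rot _ _ g1).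
- by apply: (tr _ _ g5).
- by apply: (tr _ _ g9).
- by apply: (rot _ _ g7).
- by apply: (tr _ _ g7).
- by apply: (tr _ _ g13).
- by apply: (rot _ _ g11).
- by move/eqP: R14 => ->; apply: (tr _ _ g11).
Qed.

Lemma coef_occ_enum (R : mesh12) (n k : nat) :
  (occ_enum R n)`_k = (num_occ n k R)%:R.
Proof.
rewrite /num_occ -sum1_card natr_sum coef_sum big_mkcond [RHS]big_mkcond.
by apply: eq_bigr => s _; rewrite coefXn inE eq_sym; case: eqP.
Qed.

(** The closed formula starts at n = 1; the empty permutation has no pair of positions, so every
    pattern has count 0 there. *)
Lemma num_occ0 (R R' : mesh12) (k : nat) : num_occ 0 k R = num_occ 0 k R'.
Proof.
by apply: eq_card => s; rewrite !inE /occ !eq_card0 // => -[[]].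
Qed.

Theorem theorem3p8 :
  (forall R1 R2 : mesh12,
     R1 \in fourteen_patterns -> R2 \in fourteen_patterns ->
     equidistributed R1 R2) /\
  (forall (R : mesh12) (n : nat),
     R \in fourteen_patterns -> (1 <= n)%N ->
     \sum_(s : 'S_n) 'X^(occ R s) =
       ((n - 1)`!)%:R + 'X * ((n - 1) * (n - 1)`!)%:R :> {poly int}).
Proof.
split=> [R1 R2 R1in R2in [|n] k|R [//|n] Rin _]; first exact: num_occ0.
  (* Embedded in [int], both counts are the same coefficient of one polynomial. *)
  apply/eqP; rewrite -(Num.Theory.eqr_nat int) -!coef_occ_enum.
  by rewrite !occ_enum_fourteen.
by rewrite subn1; apply: occ_enum_fourteen.
Qed.
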